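(* Let $q=p^l$ be a prime power ($p$ prime) and $\mathbb{F}_q$ the finite field of order $q$. Let $\mathcal{D}$ be a $1$-$(v,k,r)$ design with blocks $B_1,\ldots,B_b$ and let $a,d\in\mathbb{F}_p$ be such that $k\equiv a\pmod p$ and $|B_i\cap B_j|\equiv d\pmod p$ for all $i,j\in\{1,\ldots,b\}$, $i\neq j$. Let $G$ be an automorphism group of $\mathcal{D}$ which acts on $\mathcal{D}$ with $f_1$ fixed points and $n$ point orbits of length $p^\alpha$, $1\leq\alpha\leq l$, and with $f_2$ fixed blocks and $m$ block orbits of length $p^\alpha$ (and no other orbits). Let $OM1$ and $OM2$ be, respectively, the submatrix of the orbit matrix indexed by fixed blocks and fixed points, and the submatrix indexed by block orbits and point orbits of length $p^\alpha$. If $a=d$, then: 1. the linear code spanned by the rows of the matrix $[OM1,\ \sqrt{-a}\,\mathbf{1}]$ is a self-orthogonal $[f_1+1,\operatorname{rank}(OM1)]$ code over the field $\mathbb{F}$, where $\mathbb{F}=\mathbb{F}_q$ if $-a$ is a square in $\mathbb{F}_q$, and $\mathbb{F}=\mathbb{F}_{q^2}$ otherwise; 2. the linear code spanned by the rows of the matrix $OM2$ is a self-orthogonal $[n,\operatorname{rank}(OM2)]$ code over the field $\mathbb{F}_q$. If $a\neq d$, then: 1. the linear code spanned by the rows of the matrix $[\sqrt{d-a}\cdot I_{f_2},\ OM1,\ \sqrt{-d}\,\mathbf{1}]$ is a self-orthogonal $[f_2+f_1+1,f_2]$ code over the field $\mathbb{F}$, where $\mathbb{F}=\mathbb{F}_q$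 if $d-a$ and $-d$ are squares in $\mathbb{F}_q$, and $\mathbb{F}=\mathbb{F}_{q^2}$ otherwise; 2. the linear code spanned by the rows of the matrix $[\sqrt{d-a}\cdot I_m,\ OM2]$ is a self-orthogonal $[m+n,m]$ code over the field $\mathbb{F}$, where $\mathbb{F}=\mathbb{F}_q$ if $d-a$ is a square in $\mathbb{F}_q$, and $\mathbb{F}=\mathbb{F}_{q^2}$ otherwise. If $m=n$, the obtained code is self-dual.
   Context: A $1$-$(v,k,r)$ design is a finite incidence structure with $v$ points and $b$ blocks such that every block is incident with exactly $k$ points and every point is incident with exactly $r$ blocks. For blocks $B_i,B_j$, $|B_i\cap B_j|$ is the number of points incident with both. An automorphism group of $\mathcal{D}$ is a group of incidence-preserving bijections (points to points, blocks to blocks) of $\mathcal{D}$. The orbit matrix under $G$ has rows indexed by block orbits $\mathcal{B}_i$ and columns by point orbits $\mathcal{V}_j$, with entry $a_{i,j}$ equal to the number of points of $\mathcal{V}_j$ incident with a block of $\mathcal{B}_i$ (independent of the chosen block). Order the orbits so that fixed points (columns $1,\ldots,f_1$) and fixed blocks (rows $1,\ldots,f_2$) come first. Then $OM1=[a_{i,j}]_{1\le i\le f_2,\,1\le j\le f_1}$ and $OM2=[a_{f_2+i,f_1+j}]_{1\le i\le m,\,1\le j\le n}$, with entries viewed, and ranks computed, in the field under consideration. $I_N$ is the identity matrix, $\mathbf{1}$ the all-one column, and $[X,Y,\ldots]$ denotes horizontal concatenation. For $c\in\mathbb{F}_p$, viewed in $\mathbb{F}$, $\sqrt{c}$ denotes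 an element of $\mathbb{F}$ whose square is $c$. An $[N,K]$ code has length $N$ and dimension $K$. A code $C\subseteq\mathbb{F}^N$ is self-orthogonal if $C\subseteq C^\perp$ and self-dual if $C=C^\perp$, where $C^\perp$ is the dual under the standard (bilinear) inner product. *)

(* Defs.v *)
From HB Require Import structures.
From mathcomp Require Import all_boot all_order all_algebra all_fingroup.
Set Implicit Arguments.
Unset Strict Implicit.
Unset Printing Implicit Defensive.
Import GRing.Theory.
Local Open Scope ring_scope.

Section Designs.

(* An incidence structure is a relation between points and abstract blocks, so
   distinct blocks may be incident with the same points. *)
Variables (P B : finType) (inc : P -> B -> bool).

Definition block_points (y : B) : {set P} := [set x | inc x y].

Definition is_1design (v k r : nat) : Prop :=
  [/\ #|P| = v,
      forall y : B, #|block_points y| = k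
    & forall x : P, #|[set y | inc x y]| = r].

(* An automorphism is a pair of permutations because, with repeated blocks, its
   action on blocks need not be determined by its action on points. *)
Definition design_aut : {set {perm P} * {perm B}} :=
  [set g : {perm P} * {perm B} |
    [forall x : P, forall y : B, inc (g.1 x) (g.2 y) == inc x y]].

(* V enumerates point sets (columns) and W block sets (rows).  The value does
   not depend on the block picked when V and W list the orbits of a group of
   automorphisms. *)
Definition orbit_mx (c t : nat) (W : 'I_c -> {set B}) (V : 'I_t -> {set P}) :
    'M[nat]_(c, t) :=
  \matrix_(i, j)
    if [pick y in W i] is Some y then #|V j :&: block_points y| else 0%N.

End Designs.

Section Actions.

Variables P B : finType.

Definition point_actf (x : P) (g : {perm P} * {perm B}) : P := g.1 x.
Definition block_actf (y : B) (g : {perm P} * {perm B}) : B := g.2 y.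

Fact point_act1 : point_actf^~ 1%g =1 id.
Proof. by move=> x; rewrite /point_actf perm1. Qed.
Fact point_actM : forall x, act_morph point_actf x.
Proof. by move=> x g h; rewrite /point_actf permM. Qed.
Fact block_act1 : block_actf^~ 1%g =1 id.
Proof. by move=> y; rewrite /block_actf perm1. Qed.
Fact block_actM : forall y, act_morph block_actf y.
Proof. by move=> y g h; rewrite /block_actf permM. Qed.

Definition point_act := TotalAction point_act1 point_actM.
Definition block_act := TotalAction block_act1 block_actM.

End Actions.

(* V lists every orbit of G exactly once: first f orbits of length 1, then n
   orbits of length s. *)
Definition orbit_ordering (gT : finGroupType) (T : finType)
    (to : {action gT &-> T}) (G : {group gT}) (f n s : nat)
    (V : 'I_(f + n) -> {set T}) : Prop :=
  [/\ injective V,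
      [set V j | j : 'I_(f + n)] = [set orbit to G x | x : T],
      forall j : 'I_f, #|V (lshift n j)| = 1%N
    & forall j : 'I_n, #|V (rshift f j)| = s].

Section Codes.

Variable F : finFieldType.

Definition row_code (M N : nat) (A : 'M[F]_(M, N)) : {vspace 'rV[F]_N} :=
  <<[seq row i A | i : 'I_M]>>%VS.

Definition inner_prod (N : nat) (u w : 'rV[F]_N) : F :=
  \sum_(i < N) u 0 i * w 0 i.

Definition dual_code (N : nat) (C : {vspace 'rV[F]_N}) : pred 'rV[F]_N :=
  [pred w | [forall u : 'rV[F]_N, (u \in C) ==> (inner_prod u w == 0)]].

Definition self_orthogonal (N : nat) (C : {vspace 'rV[F]_N}) : Prop :=
  {subset C <= dual_code C}.

Definition self_dual (N : nat) (C : {vspace 'rV[F]_N}) : Prop :=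
  C =i dual_code C.

Definition is_code (N K : nat) (C : {vspace 'rV[F]_N}) : Prop := \dim C = K.

Definition is_square (c : F) : bool := [exists s : F, s ^+ 2 == c].

(* The embedding of the prime field when p is prime and F has characteristic p;
   the argument is read through its representative in [0, p). *)
Definition of_Fp (p : nat) (c : 'F_p) : F := (nat_of_ord c)%:R.

Definition natmx (M N : nat) (A : 'M[nat]_(M, N)) : 'M[F]_(M, N) :=
  map_mx (fun x : nat => x%:R) A.

End Codes.

Arguments is_code {F} N K C.
Arguments of_Fp F {p} c.
Arguments natmx F {M N} A.

(* Main.v *)
Require Import Defs.
From HB Require Import structures.
From mathcomp Require Import all_boot all_order all_algebra all_fingroup.
From mathcomp Require Import cyclic finfield.
Set Implicit Arguments.
Unset Strict Implicit.
Unset Printing Implicit Defensive.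
Import GRing.Theory.
Local Open Scope ring_scope.

(** Everything follows from two Gram matrices over a field of characteristic
    [p], both obtained by counting the sum of |y /\ z| over the blocks [z] of
    a block orbit [Z], for a fixed block [y]. Since distinct blocks meet in [d]
    points and a block has [a] points mod [p], this sum is |Z| d, plus a - d if
    [y] lies in [Z] ([sum_meet_mod]).

    The same sum splits over the point orbits [X]. By [sum_meet_orbit], [X]
    contributes the number of points of [y] in [X] times the number of blocks
    of [Z] through a point of [X]; and [double_count] says that the latter
    number times |X| is |Z| times the number of points of [X] on a block of [Z].
    Hence, when |X| = |Z|, the contribution is the product of the two entries
    of the orbit matrix in column [X]. When |X| and |Z| differ, one of them is
    1 and the other is a positive power of [p], and, [y] being taken in an orbit
    as long as [Z], the contribution vanishes mod [p]. So, with J the all-one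
    matrix, OM1 OM1^T = (a - d) I + d J ([gram_fixed_orbits], where |Z| = 1) and
    OM2 OM2^T = (a - d) I ([gram_long_orbits], where |Z| = 0 mod [p]).

    The parts sqrt(d - a) I and sqrt(-d) 1 are what cancels these Gram
    matrices, and a code is self-orthogonal as soon as its generator matrix has
    Gram matrix 0. Dimensions are ranks: an invertible part gives full rank,
    and if a = d the extra column is a combination of the columns of OM1,
    because the columns of OM1 OM1^T = a J are ([rank_row_mx_const]).

    The square roots exist in the stated field by Euler's criterion
    ([euler_sqrt]), which for an element of the prime field depends only on the
    order of the field, and always holds over the quadratic extension; in
    characteristic 2 every element is a square. *)

(** * Codes spanned by the rows of a matrix *)

Section RowCodes.

Variable F : finFieldType.

Lemma row_codeE M N (A : 'M[F]_(M, N)) :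
  row_code A = <<[tuple row i A | i < M]>>%VS.
Proof. by []. Qed.

Lemma mem_row_code M N (A : 'M[F]_(M, N)) (u : 'rV_N) :
  (u \in row_code A) = (u <= A)%MS.
Proof.
rewrite row_codeE; apply/idP/submxP=> [/coord_span -> | [x ->]].
  exists (\row_i coord [tuple row i A | i < M] i u).
  by rewrite mulmx_sum_row; apply: eq_bigr => i _; rewrite mxE nth_mktuple.
rewrite mulmx_sum_row; apply: memv_suml => i _; apply: memvZ.
by rewrite -(tnth_mktuple (fun i => row i A)); apply/memv_span/mem_tnth.
Qed.

(** The rows of [A] may be dependent, so the dimension is read off a row base
    of [A], which is free and spans the same code. *)
Lemma dim_row_code M N (A : 'M[F]_(M, N)) : \dim (row_code A) = \rank A.
Proof.
have ->: row_code A = row_code (row_base A).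
  by apply/vspaceP=> u; rewrite !mem_row_code eq_row_base.
suff: free [tuple row i (row_base A) | i < \rank A].
  by move/eqP; rewrite size_tuple.
apply/freeP=> c sum0 i.
have /row_free_inj inj_base := row_base_free A.
have /rowP/(_ i): \row_i c i = 0.
  apply: inj_base; rewrite mul0mx mulmx_sum_row -[RHS]sum0.
  by apply: eq_bigr => j _; rewrite mxE nth_mktuple.
by rewrite !mxE.
Qed.

Lemma mem_dual_row_code M N (A : 'M[F]_(M, N)) (w : 'rV_N) :
  (w \in dual_code (row_code A)) = (w <= kermx A^T)%MS.
Proof.
have innerE (u : 'rV_N) : inner_prod u w = (u *m w^T) 0 0.
  by rewrite mxE; apply: eq_bigr => i _; rewrite mxE.
rewrite inE; apply/forallP/sub_kermxP=> [orth | wA0 u].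
  apply: trmx_inj; rewrite trmx_mul trmxK trmx0; apply/row_matrixP=> i.
  have /implyP := orth (row i A); rewrite mem_row_code row_sub => /(_ isT)/eqP.
  rewrite innerE row0 row_mul => uw0; apply/rowP=> j.
  by rewrite ord1 uw0 mxE.
apply/implyP; rewrite mem_row_code => /submxP[x ->]; rewrite innerE.
by rewrite -mulmxA -[A]trmxK -trmx_mul wA0 trmx0 mulmx0 mxE.
Qed.

Lemma self_orthogonal_row_code M N (A : 'M[F]_(M, N)) :
  A *m A^T = 0 -> self_orthogonal (row_code A).
Proof.
move=> AA0 u; rewrite mem_row_code mem_dual_row_code => uA.
by apply: (submx_trans uA); apply/sub_kermxP.
Qed.

(** The dual code is a kernel of dimension N - rank A; the inclusion of the
    code in its dual is an equality when these dimensions agree. *)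
Lemma self_dual_row_code M N (A : 'M[F]_(M, N)) :
  A *m A^T = 0 -> (\rank A).*2 = N -> self_dual (row_code A).
Proof.
move=> /sub_kermxP subA rkA u; rewrite mem_row_code mem_dual_row_code.
suff /eqmxP-> : (A == kermx A^T)%MS by [].
rewrite -(mxrank_leqif_eq subA) mxrank_ker mxrank_tr -[X in (X - _)%N]rkA.
by rewrite -addnn addnK.
Qed.

Lemma mxrank_row_mx_maxl M N1 N2 (A : 'M[F]_(M, N1)) (A' : 'M_(M, N2)) :
  (\rank A <= \rank (row_mx A A'))%N.
Proof.
have {1}-> : A = row_mx A A' *m col_mx 1%:M 0.
  by rewrite mul_row_col mulmx0 addr0 mulmx1.
exact: mxrankM_maxl.
Qed.

Lemma rank_row_mx_full M N1 N2 (A : 'M[F]_(M, N1)) (A' : 'M_(M, N2)) :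
  \rank A = M -> \rank (row_mx A A') = M.
Proof.
move=> rkA; apply/eqP; rewrite eqn_leq rank_leq_row -[X in (X <= _)%N]rkA.
exact: mxrank_row_mx_maxl.
Qed.

Lemma rank_scalar M (s : F) : s != 0 -> \rank (s *: 1%:M : 'M_M) = M.
Proof. by move=> s0; rewrite mxrank_scale_nz ?mxrank1. Qed.

(** If c <> 0, the hypothesis on the Gram matrix puts the all-one column, hence
    the added one, in the column space of [A]; if c = 0, the added column is
    0. *)
Lemma rank_row_mx_const M N (A : 'M[F]_(M, N)) (s c : F) :
    A *m A^T = c *: const_mx 1 -> s ^+ 2 = - c ->
  \rank (row_mx A (s *: const_mx 1 : 'cV_M)) = \rank A.
Proof.
case: M A => [|M] A gramA s2; first by rewrite !flatmx0 !mxrank0.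
apply/eqP; rewrite eqn_leq mxrank_row_mx_maxl andbT.
have [-> | s0] := eqVneq s 0; first by rewrite scale0r rank_row_mx0.
have c0 : c != 0 by rewrite -oppr_eq0 -s2 expf_eq0.
(* The first column of A A^T is c times the all-one column. *)
have -> : s *: const_mx 1 = A *m ((s / c) *: col 0 A^T).
  rewrite -scalemxAr colE mulmxA gramA -scalemxAl scalerA divfK // -colE.
  by congr (_ *: _); apply/colP=> i; rewrite !mxE.
by rewrite -[X in row_mx X]mulmx1 -mul_mx_row mxrankM_maxl.
Qed.

Lemma gram_const_col M (s : F) :
  (s *: const_mx 1 : 'cV_M) *m (s *: const_mx 1 : 'cV_M)^T
    = s ^+ 2 *: const_mx 1.
Proof.
by apply/matrixP=> i j; rewrite !mxE big_ord1 !mxE !mulr1 expr2.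
Qed.

Lemma gram_scalar M (s : F) :
  (s *: 1%:M : 'M_M) *m (s *: 1%:M : 'M_M)^T = (s ^+ 2)%:M.
Proof. by rewrite scalemx1 tr_scalar_mx -scalar_mxM expr2. Qed.

End RowCodes.

(** * Square roots of elements of the prime field *)

(** Euler's criterion, in the form c^((Q + 1) / 2) = c, Q the order of the
    field, which also covers c = 0 and is an equation that can be transported
    along the prime field. Writing a nonzero [c] as g^i for a generator [g] of
    the cyclic unit group, the equation forces [i] to be even. *)
Lemma euler_sqrt (F : finFieldType) (c : F) :
  odd #|F| -> c ^+ uphalf #|F| = c -> exists s, s ^+ 2 = c.
Proof.
have [-> _ _ | c0] := eqVneq c 0; first by exists 0; rewrite expr0n.
set Q := #|F| => oddQ cQ; have Q1 : (1 < Q)%N := finNzRing_gt1 F.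
have Qh : Q.-1 = Q./2.*2 by rewrite -{1}(odd_double_half Q) oddQ.
have h0 : (0 < Q./2)%N.
  by rewrite -double_gt0 -Qh -ltnS prednK // ltnW.
have cU : c \is a GRing.unit by rewrite unitfE.
have /cyclicP[g defg] := field_unit_group_cyclic [set: {unit F}].
have og : #[g]%g = Q./2.*2.
  by rewrite -Qh -card_finField_unit defg.
have /cycleP[i ci] : FinRing.unit F cU \in <[g]>%g by rewrite -defg inE.
have ci' : c = val g ^+ i by rewrite -FinRing.val_unitX -ci.
have : (g ^+ (i * Q./2) == 1)%g.
  apply/eqP/val_inj; rewrite FinRing.val_unitX exprM -ci' /=.
  apply: (mulfI c0); rewrite mulr1 -exprS -[RHS]cQ uphalf_half oddQ.
  by rewrite add1n.
rewrite -order_dvdn og -mul2n dvdn_pmul2r // => /dvdnP[j ij].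
by exists (val g ^+ j); rewrite -exprM -ij.
Qed.

Section PrimeField.

Variables (p : nat) (F : finFieldType).
Hypotheses (p_pr : prime p) (pF : p \in [pchar F]).

Lemma of_Fp_nat (n : nat) : of_Fp F (n%:R : 'F_p) = n%:R.
Proof.
rewrite /of_Fp val_Fp_nat // {2}(divn_eq n p) natrD natrM.
by rewrite (pcharf0 pF) mulr0 add0r.
Qed.

Lemma of_FpD (c e : 'F_p) : of_Fp F (c + e) = of_Fp F c + of_Fp F e.
Proof.
by rewrite -{1}[c]natr_Zp -{1}[e]natr_Zp -natrD of_Fp_nat natrD.
Qed.

Lemma of_FpB (c e : 'F_p) : of_Fp F (c - e) = of_Fp F c - of_Fp F e.
Proof. by apply/eqP; rewrite eq_sym subr_eq -of_FpD subrK. Qed.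

Lemma of_FpN (c : 'F_p) : of_Fp F (- c) = - of_Fp F c.
Proof. by rewrite -[- c]sub0r of_FpB sub0r. Qed.

Lemma of_FpX (c : 'F_p) n : of_Fp F (c ^+ n) = of_Fp F c ^+ n.
Proof. by rewrite -{1}[c]natr_Zp -natrX of_Fp_nat natrX. Qed.

Lemma of_Fp_inj : injective (@of_Fp F p).
Proof.
move=> c e ce; apply/eqP; rewrite -subr_eq0 -[c - e]natr_Zp.
rewrite -(dvdn_pcharf (pchar_Fp p_pr)) (dvdn_pcharf pF).
by rewrite -[_%:R]/(of_Fp F (c - e)) of_FpB ce subrr.
Qed.

(** In characteristic 2, c^Q = c exhibits [c] as the square of c^(Q / 2). *)
Lemma Fp_sqrt_even (c : 'F_p) :
  ~~ odd #|F| -> exists s : F, s ^+ 2 = of_Fp F c.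
Proof.
move=> evF; exists (of_Fp F c ^+ #|F|./2).
by rewrite -exprM muln2 even_halfK // expf_card.
Qed.

End PrimeField.

Section SquareRoots.

Variables (p : nat) (K F : finFieldType).
Hypotheses (p_pr : prime p) (pK : p \in [pchar K]) (pF : p \in [pchar F]).

(** Euler's equation for [c] has the same exponent in both fields; it passes
    from [K] to the prime field, and from there to [F]. *)
Lemma Fp_sqrt_same_card (c : 'F_p) :
  #|F| = #|K| -> is_square (of_Fp K c) -> exists s : F, s ^+ 2 = of_Fp F c.
Proof.
move=> FK /existsP[s /eqP s2].
have [oddF | /Fp_sqrt_even] := boolP (odd #|F|); last exact.
apply: euler_sqrt => //; rewrite FK -of_FpX //; congr of_Fp.
apply: (of_Fp_inj p_pr pK); rewrite of_FpX // -s2 -exprM.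
by rewrite mul2n uphalfK -FK oddF add1n exprS FK expf_card -expr2.
Qed.

(** With Q the order of [K], c^Q = c in the prime field, and
    (Q^2 + 1) / 2 = Q (Q - 1) / 2 + (Q + 1) / 2, so Euler's equation in [F]
    reduces to c^Q = c. *)
Lemma Fp_sqrt_quadratic (c : 'F_p) :
  #|F| = (#|K| ^ 2)%N -> exists s : F, s ^+ 2 = of_Fp F c.
Proof.
move=> FK; have [oddF | /Fp_sqrt_even] := boolP (odd #|F|); last exact.
apply: euler_sqrt => //; rewrite -of_FpX //; congr of_Fp.
have cK : c ^+ #|K| = c.
  by apply: (of_Fp_inj p_pr pK); rewrite of_FpX // expf_card.
have oddK : odd #|K| by move: oddF; rewrite FK oddX.
have defK : #|K|./2.*2.+1 = #|K| by rewrite -[RHS]odd_double_half oddK.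
have -> : uphalf #|F| = (#|K| * #|K|./2 + uphalf #|K|)%N.
  apply: double_inj; rewrite uphalfK oddF FK doubleD uphalfK oddK doubleMr.
  by rewrite [RHS]addnCA -mulnSr defK mulnn.
by rewrite exprD exprM cK -exprD uphalf_half oddK addnCA addnn add1n defK.
Qed.

Lemma Fp_sqrt_if (b : bool) (c : 'F_p) :
    #|F| = (if b then #|K| else (#|K| ^ 2)%N) ->
    (b -> is_square (of_Fp K c)) ->
  exists s : F, s ^+ 2 = of_Fp F c.
Proof.
case: b => FK sqK; last exact: Fp_sqrt_quadratic.
exact: Fp_sqrt_same_card (sqK isT).
Qed.

End SquareRoots.

(** * Incidences between a point orbit and a block orbit *)

Section OrbitCounting.

Variables (P B : finType) (inc : P -> B -> bool).
Variable G : {group {perm P} * {perm B}}.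
Hypothesis G_aut : G \subset design_aut inc.

Local Notation pact := (point_act P B).
Local Notation bact := (block_act P B).

Lemma inc_aut g x y : g \in G -> inc (pact x g) (bact y g) = inc x y.
Proof.
by move/(subsetP G_aut); rewrite inE => /forallP/(_ x)/forallP/(_ y)/eqP.
Qed.

Definition block_degree (X : {set P}) (y : B) : nat := \sum_(x in X) inc x y.

Definition point_degree (Y : {set B}) (x : P) : nat := \sum_(y in Y) inc x y.

Lemma card_block_points X y : #|X :&: block_points inc y| = block_degree X y.
Proof.
rewrite /block_degree -sum1_card big_mkcond [RHS]big_mkcond.
by apply: eq_bigr => x _; rewrite !inE; case: (x \in X); case: inc.
Qed.

Lemma block_degree_orbit x0 y g : g \in G ->
  block_degree (orbit pact G x0) (bact y g) = block_degree (orbit pact G x0) y.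
Proof.
move=> gG; rewrite /block_degree (reindex_inj (act_inj pact g)).
apply: eq_big => [x | x _]; last by rewrite inc_aut.
by rewrite orbit_actr.
Qed.

Lemma point_degree_orbit y0 x g : g \in G ->
  point_degree (orbit bact G y0) (pact x g) = point_degree (orbit bact G y0) x.
Proof.
move=> gG; rewrite /point_degree (reindex_inj (act_inj bact g)).
apply: eq_big => [y | y _]; last by rewrite inc_aut.
by rewrite orbit_actr.
Qed.

(** Both sides count the incident pairs between the two orbits, as the degrees
    are constant on each orbit. *)
Lemma double_count x0 y0 :
  (#|orbit pact G x0| * point_degree (orbit bact G y0) x0
    = #|orbit bact G y0| * block_degree (orbit pact G x0) y0)%N.
Proof.
transitivity (\sum_(x in orbit pact G x0) point_degree (orbit bact G y0) x)%N.
  rewrite -sum_nat_const; apply: eq_bigr => _ /orbitP[g gG <-].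
  by rewrite point_degree_orbit.
rewrite /point_degree exchange_big -sum_nat_const.
by apply: eq_bigr => _ /orbitP[g gG <-]; rewrite -(block_degree_orbit _ _ gG).
Qed.

Lemma point_degree_same_length x0 y0 :
  #|orbit pact G x0| = #|orbit bact G y0| ->
  point_degree (orbit bact G y0) x0 = block_degree (orbit pact G x0) y0.
Proof.
move=> eqXY; have /eqP := double_count x0 y0.
rewrite eqXY eqn_mul2l; case/orP=> [|/eqP //].
by rewrite cards_eq0 => /eqP Y0; have := orbit_refl bact G y0; rewrite Y0 inE.
Qed.

Lemma sum_meet (Z : {set B}) y :
  (\sum_(z in Z) #|block_points inc y :&: block_points inc z|
    = \sum_x inc x y * point_degree Z x)%N.
Proof.
under eq_bigr => z _.
  rewrite card_block_points /block_degree big_mkcond; over.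
rewrite exchange_big; apply: eq_bigr => x _; rewrite /point_degree big_distrr.
by apply: eq_bigr => z _; rewrite inE /=; case: (inc x y); rewrite ?mul1n.
Qed.

Lemma sum_meet_orbit x0 y z0 :
  (\sum_(x in orbit pact G x0) inc x y * point_degree (orbit bact G z0) x
    = block_degree (orbit pact G x0) y * point_degree (orbit bact G z0) x0)%N.
Proof.
rewrite [RHS]big_distrl; apply: eq_bigr => _ /orbitP[g gG <-] /=.
by rewrite point_degree_orbit.
Qed.

(** Frees the entry from the block picked in its definition: any representative
    of the block orbit can be used. *)
Lemma orbit_mx_entry c t (W : 'I_c -> {set B}) (V : 'I_t -> {set P}) i j x y :
    V j = orbit pact G x -> W i = orbit bact G y ->
  orbit_mx inc W V i j = block_degree (V j) y.
Proof.
move=> defV defW; rewrite mxE defV; case: pickP => [z | /(_ y)].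
  rewrite defW => /orbitP[g gG <-]; rewrite card_block_points.
  by rewrite block_degree_orbit.
by rewrite defW orbit_refl.
Qed.

End OrbitCounting.

(** * Sums along an ordered list of orbits *)

Section OrbitOrdering.

Variables (gT : finGroupType) (T : finType) (to : {action gT &-> T}).
Variables (G : {group gT}) (f n s : nat) (V : 'I_(f + n) -> {set T}).
Hypothesis ordV : orbit_ordering to G s V.

Lemma orbit_ordering_rep j : exists x, V j = orbit to G x.
Proof.
have [_ defV _ _] := ordV.
have : V j \in [set V j | j : 'I_(f + n)] by apply: imset_f.
by rewrite defV => /imsetP[x _ ->]; exists x.
Qed.

Lemma mem_orbit_ordering i j x : V i = orbit to G x -> (x \in V j) = (i == j).
Proof.
move=> defVi; have [injV _ _ _] := ordV; have [z defVj] := orbit_ordering_rep j.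
by rewrite -(inj_eq injV) defVi defVj orbit_eq_mem.
Qed.

Lemma sum_orbit_ordering (E : T -> nat) :
  (\sum_x E x = \sum_(j < f) \sum_(x in V (lshift n j)) E x
              + \sum_(j < n) \sum_(x in V (rshift f j)) E x)%N.
Proof.
have [injV defV _ _] := ordV.
have partV : partition [set V j | j : 'I_(f + n)] [set: T].
  have -> : [set V j | j : 'I_(f + n)] = [set orbit to G x | x in [set: T]].
    by rewrite defV; apply/setP=> A; apply/imsetP/imsetP=> -[x _ ->]; exists x.
  by apply: orbit_partition; apply/actsP=> g _ x; rewrite !inE.
transitivity (\sum_(x in [set: T]) E x)%N.
  by apply: eq_bigl => x; rewrite inE.
rewrite (set_partition_big _ partV) /= big_imset /=.
  by rewrite big_split_ord.
by move=> ? ? _ _ /injV.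
Qed.

End OrbitOrdering.

(** * Gram matrices of the orbit matrices *)

Section GramMatrices.

Variables (P B : finType) (inc : P -> B -> bool).
Variable G : {group {perm P} * {perm B}}.
Hypothesis G_aut : G \subset design_aut inc.
Variables (f1 n f2 m s : nat).
Variables (V : 'I_(f1 + n) -> {set P}) (W : 'I_(f2 + m) -> {set B}).
Hypothesis ordV : orbit_ordering (point_act P B) G s V.
Hypothesis ordW : orbit_ordering (block_act P B) G s W.

Variables (F : finFieldType) (a d : F).
Hypothesis s0 : s%:R = 0 :> F.
Hypothesis size_block : forall y, #|block_points inc y|%:R = a.
Hypothesis size_meet : forall y z, y != z ->
  #|block_points inc y :&: block_points inc z|%:R = d.

Lemma sum_meet_mod (Z : {set B}) y :
  (\sum_(z in Z) #|block_points inc y :&: block_points inc z|)%:R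
    = #|Z|%:R * d + (y \in Z)%:R * (a - d).
Proof.
rewrite natr_sum; have [yZ | yZ] := boolP (y \in Z).
  rewrite (bigD1 y) //= setIid size_block (cardsD1 y) yZ.
  rewrite (eq_bigr (fun=> d)) => [|z /andP[_ zy]]; last first.
    by rewrite size_meet // eq_sym.
  rewrite (eq_bigl (mem (Z :\ y))) => [|z]; last by rewrite !inE andbC.
  rewrite sumr_const natrD mulrDl !mul1r mulr_natl.
  by rewrite [d + _]addrC -addrA [d + _]addrC subrK addrC.
rewrite mul0r addr0 mulr_natl -sumr_const; apply: eq_bigr => z zZ.
by rewrite size_meet //; apply: contraNneq yZ => ->.
Qed.

(** For a fixed block [y], a point orbit of length [s] is contained in [y] or
    disjoint from it, so it contributes 0 to the intersection numbers: only the
    fixed points are left. *)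
Lemma gram_fixed_orbits :
  let A := natmx F (ulsubmx (orbit_mx inc W V)) in
  A *m A^T = (a - d)%:M + d *: const_mx 1.
Proof.
move=> A; have [_ _ V1 Vs] := ordV; have [_ _ W1 _] := ordW.
have entA i j x y : V (lshift n j) = orbit (point_act P B) G x ->
    W (lshift m i) = orbit (block_act P B) G y ->
  A i j = (block_degree inc (V (lshift n j)) y)%:R.
  by move=> defx defy; rewrite -(orbit_mx_entry G_aut defx defy) !mxE.
apply/matrixP=> i i'; rewrite !mxE mulr1.
have [y defy] := orbit_ordering_rep ordW (lshift m i).
have [z defz] := orbit_ordering_rep ordW (lshift m i').
have := sum_meet_mod (W (lshift m i')) y.
rewrite W1 mul1r (mem_orbit_ordering ordW _ defy).
rewrite (inj_eq (@lshift_inj _ _)) mulr_natl addrC => <-.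
rewrite sum_meet (sum_orbit_ordering ordV) natrD !natr_sum.
rewrite [X in _ + X]big1 ?addr0 => [|j _].
  apply: eq_bigr => j _; rewrite [A^T j i']mxE.
  have [x defx] := orbit_ordering_rep ordV (lshift n j).
  rewrite (entA _ _ _ _ defx defy) (entA _ _ _ _ defx defz).
  rewrite defx defz (sum_meet_orbit G_aut) natrM.
  by rewrite (point_degree_same_length G_aut) // -defx -defz V1 W1.
have [x defx] := orbit_ordering_rep ordV (rshift f1 j).
rewrite defx defz (sum_meet_orbit G_aut) natrM.
(* The entry of column j is s times a point degree, hence 0 in F. *)
have := double_count G_aut x y; rewrite -defy W1 mul1n => <-.
by rewrite -defx Vs natrM s0 !mul0r.
Qed.

(** Here it is the fixed points that contribute 0: a fixed point is on all or
    none of the [s] blocks of an orbit. *)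
Lemma gram_long_orbits :
  let A := natmx F (drsubmx (orbit_mx inc W V)) in A *m A^T = (a - d)%:M.
Proof.
move=> A; have [_ _ V1 Vs] := ordV; have [_ _ _ Ws] := ordW.
have entA i j x y : V (rshift f1 j) = orbit (point_act P B) G x ->
    W (rshift f2 i) = orbit (block_act P B) G y ->
  A i j = (block_degree inc (V (rshift f1 j)) y)%:R.
  by move=> defx defy; rewrite -(orbit_mx_entry G_aut defx defy) !mxE.
apply/matrixP=> i i'; rewrite !mxE.
have [y defy] := orbit_ordering_rep ordW (rshift f2 i).
have [z defz] := orbit_ordering_rep ordW (rshift f2 i').
have := sum_meet_mod (W (rshift f2 i')) y.
rewrite Ws s0 mul0r add0r (mem_orbit_ordering ordW _ defy).
rewrite (inj_eq (@rshift_inj _ _)) mulr_natl => <-.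
rewrite sum_meet (sum_orbit_ordering ordV) natrD !natr_sum.
rewrite [X in X + _]big1 ?add0r => [|j _].
  apply: eq_bigr => j _; rewrite [A^T j i']mxE.
  have [x defx] := orbit_ordering_rep ordV (rshift f1 j).
  rewrite (entA _ _ _ _ defx defy) (entA _ _ _ _ defx defz).
  rewrite defx defz (sum_meet_orbit G_aut) natrM.
  by rewrite (point_degree_same_length G_aut) // -defx -defz Vs Ws.
have [x defx] := orbit_ordering_rep ordV (lshift n j).
rewrite defx defz (sum_meet_orbit G_aut) natrM.
(* The point degree is s times the entry of column j, hence 0 in F. *)
have := double_count G_aut x z; rewrite -defx V1 mul1n => ->.
by rewrite -defz Ws natrM s0 mul0r mulr0.
Qed.

End GramMatrices.
Theorem theorem21
  (p l : nat) (p_prime : prime p)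
  (Fq : finFieldType) (card_Fq : #|Fq| = (p ^ l)%N)
  (P B : finType) (inc : P -> B -> bool) (v k r : nat)
  (designD : is_1design inc v k r)
  (a d : 'F_p) (k_mod : k%:R = a)
  (meet_mod : forall y z : B, y != z ->
     #|block_points inc y :&: block_points inc z|%:R = d)
  (G : {group {perm P} * {perm B}}) (G_aut : G \subset design_aut inc)
  (alpha : nat) (alpha_bounds : (1 <= alpha <= l)%N)
  (f1 n f2 m : nat)
  (V : 'I_(f1 + n) -> {set P}) (W : 'I_(f2 + m) -> {set B})
  (V_orbits : orbit_ordering (point_act P B) G (p ^ alpha) V)
  (W_orbits : orbit_ordering (block_act P B) G (p ^ alpha) W) :
  let OM1 : 'M[nat]_(f2, f1) := ulsubmx (orbit_mx inc W V) in
  let OM2 : 'M[nat]_(m, n) := drsubmx (orbit_mx inc W V) in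
  (a = d ->
     (forall F : finFieldType,
        #|F| = (if is_square (- of_Fp Fq a) then #|Fq| else (#|Fq| ^ 2)%N) ->
        (exists s : F, s ^+ 2 = - of_Fp F a) /\
        (forall s : F, s ^+ 2 = - of_Fp F a ->
           let C := row_code
             (row_mx (natmx F OM1) (s *: const_mx 1 : 'cV[F]_f2)) in
           is_code (f1 + 1) (\rank (natmx F OM1)) C /\ self_orthogonal C))
     /\
     (let C := row_code (natmx Fq OM2) in
      is_code n (\rank (natmx Fq OM2)) C /\ self_orthogonal C))
  /\
  (a != d ->
     (forall F : finFieldType,
        #|F| = (if is_square (of_Fp Fq d - of_Fp Fq a)
                   && is_square (- of_Fp Fq d)
                then #|Fq| else (#|Fq| ^ 2)%N) ->
        (exists s : F, s ^+ 2 = of_Fp F d - of_Fp F a) /\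
        (exists t : F, t ^+ 2 = - of_Fp F d) /\
        (forall s t : F,
           s ^+ 2 = of_Fp F d - of_Fp F a -> t ^+ 2 = - of_Fp F d ->
           let C := row_code
             (row_mx (row_mx (s *: 1%:M : 'M[F]_f2) (natmx F OM1))
                     (t *: const_mx 1 : 'cV[F]_f2)) in
           is_code (f2 + f1 + 1) f2 C /\ self_orthogonal C))
     /\
     (forall F : finFieldType,
        #|F| = (if is_square (of_Fp Fq d - of_Fp Fq a)
                then #|Fq| else (#|Fq| ^ 2)%N) ->
        (exists s : F, s ^+ 2 = of_Fp F d - of_Fp F a) /\
        (forall s : F, s ^+ 2 = of_Fp F d - of_Fp F a ->
           let C := row_code
             (row_mx (s *: 1%:M : 'M[F]_m) (natmx F OM2)) in
           [/\ is_code (m + n) m C, self_orthogonal C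
             & m = n -> self_dual C]))).

Proof.
move=> OM1 OM2; have [_ size_bl _] := designD.
have [alpha_gt0 _] := andP alpha_bounds.
have pFq : p \in [pchar Fq] := card_finPcharP card_Fq p_prime.
have pF (F : finFieldType) b :
    #|F| = (if b then #|Fq| else (#|Fq| ^ 2)%N) -> p \in [pchar F].
  by case: b; rewrite card_Fq -?expnM => cardF; apply: card_finPcharP cardF _.
have s0 (F : finFieldType) : p \in [pchar F] -> (p ^ alpha)%:R = 0 :> F.
  by move=> chF; rewrite natrX (pcharf0 chF) expr0n gtn_eqF.
have kF (F : finFieldType) : p \in [pchar F] ->
    forall y, #|block_points inc y|%:R = of_Fp F a.
  by move=> chF y; rewrite size_bl -k_mod of_Fp_nat.
have meetF (F : finFieldType) : p \in [pchar F] -> forall y z, y != z ->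
    #|block_points inc y :&: block_points inc z|%:R = of_Fp F d.
  by move=> chF y z yz; rewrite -(meet_mod y z yz) of_Fp_nat.
have gram1 (F : finFieldType) (chF : p \in [pchar F]) :=
  gram_fixed_orbits G_aut V_orbits W_orbits (s0 F chF) (kF F chF) (meetF F chF).
have gram2 (F : finFieldType) (chF : p \in [pchar F]) :=
  gram_long_orbits G_aut V_orbits W_orbits (s0 F chF) (kF F chF) (meetF F chF).
rewrite -/OM1 -/OM2 /= in gram1 gram2.
split=> [a_d | a_d]; split.
- move=> F cardF; have chF := pF _ _ cardF.
  have gram : natmx F OM1 *m (natmx F OM1)^T = of_Fp F a *: const_mx 1.
    by rewrite gram1 // -a_d subrr raddf0 add0r.
  split=> [|s s2].
    rewrite -of_FpN //; apply: Fp_sqrt_if cardF _ => //.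
    by rewrite of_FpN.
  split; first by rewrite /is_code dim_row_code (rank_row_mx_const gram).
  apply: self_orthogonal_row_code.
  rewrite tr_row_mx mul_row_col gram gram_const_col s2.
  by rewrite -scalerDl subrr scale0r.
- split; first by rewrite /is_code dim_row_code.
  by apply: self_orthogonal_row_code; rewrite gram2 // a_d subrr raddf0.
- move=> F cardF; have chF := pF _ _ cardF.
  split; first (rewrite -of_FpB //; apply: Fp_sqrt_if cardF _ => //).
    by rewrite of_FpB // => /andP[].
  split; first (rewrite -of_FpN //; apply: Fp_sqrt_if cardF _ => //).
    by rewrite of_FpN // => /andP[].
  move=> s t s2 t2.
  have s_neq0 : s != 0.
    by rewrite -sqrf_eq0 s2 subr_eq0 (inj_eq (of_Fp_inj p_prime chF)) eq_sym.
  split.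
    rewrite /is_code dim_row_code.
    by do 2!apply: rank_row_mx_full; apply: rank_scalar.
  apply: self_orthogonal_row_code.
  rewrite !tr_row_mx !mul_row_col gram1 // gram_const_col gram_scalar s2 t2.
  by rewrite addrA scaleNr addrK -raddfD /= subrKA subrr raddf0.
- move=> F cardF; have chF := pF _ _ cardF.
  split; first (rewrite -of_FpB //; apply: Fp_sqrt_if cardF _ => //).
    by rewrite of_FpB.
  move=> s s2.
  have s_neq0 : s != 0.
    by rewrite -sqrf_eq0 s2 subr_eq0 (inj_eq (of_Fp_inj p_prime chF)) eq_sym.
  set A := row_mx _ _.
  have rkA : \rank A = m by apply/rank_row_mx_full/rank_scalar.
  have AA0 : A *m A^T = 0.
    rewrite tr_row_mx mul_row_col gram2 // gram_scalar s2 -raddfD /=.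
    by rewrite subrKA subrr raddf0.
  split; [by rewrite /is_code dim_row_code | exact: self_orthogonal_row_code |].
  by move=> mn; apply: self_dual_row_code; rewrite ?rkA -?addnn // -mn.
Qed.
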